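(* Let $d\ge2$, $\varepsilon\ge1$, $s=\lceil d/(1+e^\varepsilon)\rceil$. Let $q^{\mathrm{ss}}$ be the $\varepsilon$-LDP $\texttt{Subset Selection}$ mechanism with estimator $\hat{\mathbf{x}}^{\mathrm{ss}}=(\mathbf{z}-b_{\mathrm{ss}}\mathbf{1})/m_{\mathrm{ss}}$, and let $q^{\mathrm{mrc}}$ be the MRC mechanism simulating it with $N$ candidates and estimator $\hat{\mathbf{x}}^{\mathrm{mrc}}=(\mathbf{z}_K-b_{\mathrm{mrc}}\mathbf{1})/m_{\mathrm{mrc}}$. Let $\lambda>0$. If \[ N\ge\frac{2(e^\varepsilon+3)^2(1+\lambda)^2}{0.24^2\lambda^2}\ln\Big(\frac{8(1+\lambda)}{0.24\lambda}\Big), \] then for every $\mathbf{x}\in\{e_1,\dots,e_d\}$, \[ \mathbb{E}_{q^{\mathrm{mrc}}}\big[\|\hat{\mathbf{x}}^{\mathrm{mrc}}-\mathbf{x}\|_2^2\big]\le(1+4\lambda+5\lambda^2+2\lambda^3)\,\mathbb{E}_{q^{\mathrm{ss}}}\big[\|\hat{\mathbf{x}}^{\mathrm{ss}}-\mathbf{x}\|_2^2\big]. \]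
   Context: $\texttt{Subset Selection}$: inputs $\{e_1,\dots,e_d\}$ (standard basis); outputs $\mathcal{Z}=\{\mathbf{z}\in\{0,1\}^d:\sum_iz_i=s\}$; for $\mathbf{x}=e_j$, $q^{\mathrm{ss}}(\mathbf{z}\mid\mathbf{x})=\frac{e^\varepsilon}{\binom{d-1}{s-1}e^\varepsilon+\binom{d-1}{s}}$ if $z_j=1$ and $\frac{1}{\binom{d-1}{s-1}e^\varepsilon+\binom{d-1}{s}}$ otherwise; $m_{\mathrm{ss}}=\frac{s(d-s)(e^\varepsilon-1)}{(d-1)(s(e^\varepsilon-1)+d)}$, $b_{\mathrm{ss}}=\frac{s((s-1)e^\varepsilon+(d-s))}{(d-1)(s(e^\varepsilon-1)+d)}$; $\mathbf{1}$ is the all-ones vector. MRC: draw $\mathbf{z}_1,\dots,\mathbf{z}_N$ i.i.d. uniform on $\mathcal{Z}$, $\pi^{\mathrm{mrc}}(k)=q^{\mathrm{ss}}(\mathbf{z}_k\mid\mathbf{x})/\sum_{k'}q^{\mathrm{ss}}(\mathbf{z}_{k'}\mid\mathbf{x})$, $K\sim\pi^{\mathrm{mrc}}$. Let $\theta$ be a random variable with $N\theta\sim\mathrm{Binom}(N,s/d)$ and define $m_{\mathrm{mrc}}=\mathbb{E}\big[\frac{\theta e^\varepsilon}{e^\varepsilon\theta+(1-\theta)}\big]-\frac{1}{d-1}\mathbb{E}\big[s-\frac{e^\varepsilon\theta}{e^\varepsilon\theta+(1-\theta)}\big]$ and $b_{\mathrm{mrc}}=\frac{1}{d-1}\mathbb{E}\big[s-\frac{e^\varepsilon\theta}{e^\varepsilon\theta+(1-\theta)}\big]$.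 Expectations under $q^{\mathrm{mrc}}$ are over the candidates and $K$. *)

(* Defs.v *)
From HB Require Import structures.
From mathcomp Require Import all_boot all_order all_algebra.
From mathcomp Require Import all_classical all_reals all_analysis.
Set Implicit Arguments. Unset Strict Implicit. Unset Printing Implicit Defensive.
Import Order.TTheory GRing.Theory Num.Theory.
Local Open Scope ring_scope.

Section SubsetSelection.
Variable R : realType.

(* s = ceil(d / (1 + e^eps)), as a natural number (the ceiling is positive) *)
Definition ss_s (d : nat) (eps : R) : nat :=
  `|Num.ceil (d%:R / (1 + expR eps))|%N.

Definition Zset (d s : nat) : {set {ffun 'I_d -> bool}} :=
  [set z : {ffun 'I_d -> bool} | (\sum_(i < d) (z i : nat))%N == s].

Definition q_ss (d s : nat) (eps : R) (j : 'I_d) (z : {ffun 'I_d -> bool}) : R :=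
  (if z j then expR eps else 1) /
  ('C(d.-1, s.-1)%:R * expR eps + 'C(d.-1, s)%:R).

Definition m_ss (d s : nat) (eps : R) : R :=
  (s%:R * (d%:R - s%:R) * (expR eps - 1)) /
  ((d%:R - 1) * (s%:R * (expR eps - 1) + d%:R)).

Definition b_ss (d s : nat) (eps : R) : R :=
  (s%:R * ((s%:R - 1) * expR eps + (d%:R - s%:R))) /
  ((d%:R - 1) * (s%:R * (expR eps - 1) + d%:R)).

Definition sqerr (d : nat) (m b : R) (j : 'I_d) (z : {ffun 'I_d -> bool}) : R :=
  \sum_(i < d) (((z i)%:R - b) / m - (i == j)%:R) ^+ 2.

Definition mse_ss (d s : nat) (eps : R) (j : 'I_d) : R :=
  \sum_(z in Zset d s) q_ss s eps j z * sqerr (m_ss d s eps) (b_ss d s eps) j z.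

Definition Ebinom (N : nat) (p : R) (f : R -> R) : R :=
  \sum_(i < N.+1) 'C(N, i)%:R * p ^+ i * (1 - p) ^+ (N - i) * f (i%:R / N%:R).

Definition g_mrc (eps : R) (theta : R) : R :=
  expR eps * theta / (expR eps * theta + (1 - theta)).

Definition b_mrc (N d s : nat) (eps : R) : R :=
  (d%:R - 1)^-1 * Ebinom N (s%:R / d%:R) (fun t => s%:R - g_mrc eps t).

Definition m_mrc (N d s : nat) (eps : R) : R :=
  Ebinom N (s%:R / d%:R) (g_mrc eps)
  - (d%:R - 1)^-1 * Ebinom N (s%:R / d%:R) (fun t => s%:R - g_mrc eps t).

Definition Cands (N d s : nat) : {set {ffun 'I_N -> {ffun 'I_d -> bool}}} :=
  [set c : {ffun 'I_N -> {ffun 'I_d -> bool}} | [forall k, c k \in Zset d s]].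

Definition pi_mrc (N d s : nat) (eps : R) (j : 'I_d)
    (c : {ffun 'I_N -> {ffun 'I_d -> bool}}) (k : 'I_N) : R :=
  q_ss s eps j (c k) / \sum_(k' < N) q_ss s eps j (c k').

(* E_{q^mrc}[ || xhat^mrc - e_j ||^2 ]: candidates i.i.d. uniform on Z, K ~ pi^mrc *)
Definition mse_mrc (N d s : nat) (eps : R) (j : 'I_d) : R :=
  \sum_(c in Cands N d s)
    (#|Zset d s|%:R ^+ N)^-1 *
    \sum_(k < N) pi_mrc s eps j c k *
      sqerr (m_mrc N d s eps) (b_mrc N d s eps) j (c k).

End SubsetSelection.

(* Main.v *)
(** For an [s]-subset [z] the squared error is affine in the bit [z j], so both
    mean squared errors are the same function [debiased_mse] of the probability
    [P] that the released subset contains the input coordinate [j].  With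
    [p = s / d] and [g = g_mrc eps], Subset Selection has [P = Q := g p] and MRC
    has [P = E (g theta)], because importance sampling turns a fraction [t] of
    candidates containing [j] into the probability [g t].  The function [g] is
    concave with an explicit second-order Taylor remainder, so the variance
    [p (1 - p) / N] of [theta] gives [0 <= Q - P <= delta / A * (Q - p)], where
    [delta = exp eps / N] and [A = tilt_mass eps p].  Passing from [Q] to [P]
    therefore multiplies the scale of the estimator by at least [1 - delta] and
    the variance of the subset by at most [1 + 2 delta].  The sample size forces
    [delta <= lambda / (1 + lambda)], and the claimed constant is
    [(1 + lambda)^2 (1 + 2 lambda)]. *)

Require Import Defs.
From HB Require Import structures.
From mathcomp Require Import all_boot all_order all_algebra.
From mathcomp Require Import all_classical all_reals all_analysis.
From mathcomp Require Import ring lra.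
Set Implicit Arguments.
Unset Strict Implicit.
Unset Printing Implicit Defensive.
Import Order.TTheory GRing.Theory Num.Theory.
Local Open Scope ring_scope.

Section BinomialMoments.
Variable R : comNzRingType.
Implicit Types (p c : R) (f g : nat -> R).

Definition binom_mean (N : nat) p f : R :=
  \sum_(i < N.+1) 'C(N, i)%:R * p ^+ i * (1 - p) ^+ (N - i) * f i.

Lemma eq_binom_mean N p f g : f =1 g -> binom_mean N p f = binom_mean N p g.
Proof. by move=> fg; apply: eq_bigr => i _; rewrite fg. Qed.

Lemma binom_meanS N p f :
  binom_mean N.+1 p f =
  p * binom_mean N p (fun i => f i.+1) + (1 - p) * binom_mean N p f.
Proof.
rewrite /binom_mean big_ord_recl /= bin0 expr0 !mul1r.
under eq_bigr => i _ do rewrite binS natrD !mulrDl.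
rewrite big_split /= addrCA addrA addrC; congr (_ + _).
  rewrite mulr_sumr; apply: eq_bigr => i _.
  by rewrite /bump /= add1n subSS exprS; ring.
rewrite mulr_sumr.
transitivity
  (\sum_(i < N.+2) 'C(N, i)%:R * p ^+ i * (1 - p) ^+ (N.+1 - i) * f i).
  by rewrite [RHS]big_ord_recl /= bin0 expr0 !mul1r addrC.
rewrite big_ord_recr /= bin_small // !mul0r addr0.
apply: eq_bigr => i _; rewrite subSn; last by rewrite -ltnS.
by rewrite exprS; ring.
Qed.

Lemma binom_meanD N p f g :
  binom_mean N p (fun i => f i + g i) = binom_mean N p f + binom_mean N p g.
Proof. by rewrite -big_split; apply: eq_bigr => i _; rewrite mulrDr. Qed.

Lemma binom_meanZ N p c f :
  binom_mean N p (fun i => c * f i) = c * binom_mean N p f.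
Proof. by rewrite [RHS]mulr_sumr; apply: eq_bigr => i _; rewrite mulrCA. Qed.

Lemma binom_mean_cst N p c : binom_mean N p (fun=> c) = c.
Proof.
elim: N => [|N IHN]; last by rewrite binom_meanS IHN; ring.
by rewrite /binom_mean big_ord1 bin0 !expr0 !mul1r.
Qed.

Lemma binom_mean_nat N p : binom_mean N p (fun i => i%:R) = N%:R * p.
Proof.
elim: N => [|N IHN]; first by rewrite /binom_mean big_ord1 mulr0 mul0r.
rewrite binom_meanS (eq_binom_mean _ _ (fun i => esym (natr1 i))).
by rewrite binom_meanD binom_mean_cst IHN -natr1; ring.
Qed.

Lemma binom_mean_sqr N p :
  binom_mean N p (fun i => i%:R ^+ 2) = N%:R * p * (1 - p) + (N%:R * p) ^+ 2.
Proof.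
elim: N => [|N IHN].
  by rewrite /binom_mean big_ord1 expr0n mulr0 !mul0r expr0n addr0.
have sqrS i : i.+1%:R ^+ 2 = i%:R ^+ 2 + (2 * i%:R + 1) :> R.
  by rewrite -natr1; ring.
rewrite binom_meanS (eq_binom_mean _ _ sqrS) !binom_meanD binom_meanZ.
by rewrite binom_mean_cst binom_mean_nat IHN -natr1; ring.
Qed.

End BinomialMoments.

Section BinomialExpectation.
Variable R : realType.
Implicit Types (p c : R) (f g : R -> R).

Lemma EbinomE N p f :
  Ebinom N p f = binom_mean N p (fun i => f (i%:R / N%:R)).
Proof. by []. Qed.

Lemma EbinomBl N p c f : Ebinom N p (fun t => c - f t) = c - Ebinom N p f.
Proof.
rewrite !EbinomE -mulN1r -binom_meanZ -[c in RHS](binom_mean_cst N p).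
by rewrite -binom_meanD; apply: eq_binom_mean => i; rewrite mulN1r.
Qed.

Lemma Ebinom_le N p f g : (0 < N)%N -> 0 <= p <= 1 ->
  (forall t, 0 <= t <= 1 -> f t <= g t) -> Ebinom N p f <= Ebinom N p g.
Proof.
move=> N0 /andP[p0 p1] fg; apply: ler_sum => i _.
apply: ler_wpM2l; first by rewrite !mulr_ge0 ?exprn_ge0 ?subr_ge0.
by apply: fg; rewrite divr_ge0 //= ler_pdivrMr ?ltr0n // mul1r ler_nat -ltnS.
Qed.

Lemma Ebinom_quadratic N p c0 c1 c2 : (0 < N)%N ->
  Ebinom N p (fun t => c0 + c1 * (t - p) + c2 * (t - p) ^+ 2) =
  c0 + c2 * (p * (1 - p) / N%:R).
Proof.
move=> N0; have NR0 : N%:R != 0 :> R by rewrite pnatr_eq0 -lt0n.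
have quadE i : c0 + c1 * (i%:R / N%:R - p) + c2 * (i%:R / N%:R - p) ^+ 2 =
    c2 / N%:R ^+ 2 * i%:R ^+ 2
    + ((c1 - 2 * c2 * p) / N%:R * i%:R + (c0 - c1 * p + c2 * p ^+ 2)).
  by field.
rewrite EbinomE (eq_binom_mean _ _ quadE) 2!binom_meanD 2!binom_meanZ.
by rewrite binom_mean_cst binom_mean_nat binom_mean_sqr; field.
Qed.

End BinomialExpectation.

Section IndependentTrials.

Lemma sum_bool_pred (R : pzSemiRingType) (I : finType) (A P : pred I)
    (F : bool -> R) :
  \sum_(i | A i) F (P i) =
  #|[set i | A i & P i]%SET|%:R * F true
  + #|[set i | A i & ~~ P i]%SET|%:R * F false.
Proof.
rewrite (bigID P) /= !mulr_natl !cardsE -!sumr_const; congr (_ + _).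
  by apply: eq_bigr => i /andP[_ ->].
by apply: eq_bigr => i /andP[_ /negbTE->].
Qed.

Lemma card_bool_pred (I : finType) (A P : pred I) :
  #|A| = (#|[set i | A i & P i]%SET| + #|[set i | A i & ~~ P i]%SET|)%N.
Proof.
rewrite -(cardID P A) !cardsE; congr (_ + _)%N.
by apply: eq_card => i; rewrite !inE andbC.
Qed.

Lemma sum_card_set (V : nmodType) (T : finType) (F : nat -> V) :
  \sum_(A : {set T}) F #|A| = \sum_(i < #|T|.+1) F i *+ 'C(#|T|, i).
Proof.
rewrite (partition_big (fun A : {set T} => inord #|A| : 'I_#|T|.+1) predT) //=.
apply: eq_bigr => i _; rewrite -card_draws -sumr_const.
have inord_card (A : {set T}) : (inord #|A| == i) = (#|A| == i).
  by rewrite -val_eqE /= inordK // ltnS max_card.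
by apply: eq_big => A; rewrite inord_card ?inE // => /eqP->.
Qed.

Lemma prodr_in_set (R : comNzRingType) (I : finType) (A : {set I}) (x y : R) :
  \prod_i (if i \in A then x else y) = x ^+ #|A| * y ^+ (#|I| - #|A|).
Proof.
by rewrite big_if /= !prodr_const -(cardC (mem A)) addKn.
Qed.

Lemma mean_success_count (R : comNzRingType) (I T : finType) (Z P : pred T)
    (w : T -> R) (F : nat -> R) :
  \sum_(t | Z t) w t = 1 ->
  \sum_(c in ffun_on Z)
    (\prod_(k : I) w (c k)) * F #|[set k | P (c k)]%SET| =
  binom_mean #|I| (\sum_(t | Z t && P t) w t) F.
Proof.
set p := \sum_(t | Z t && P t) w t => w1.
have w_failure : \sum_(t | Z t && ~~ P t) w t = 1 - p.
  by rewrite -w1 [in RHS](bigID P) /= -/p addrAC subrr add0r.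
pose successes (c : {ffun I -> T}) := [set k | P (c k)]%SET.
rewrite (partition_big successes predT) //=.
transitivity (\sum_(A : {set I}) p ^+ #|A| * (1 - p) ^+ (#|I| - #|A|) * F #|A|).
  apply: eq_bigr => A _; rewrite -prodr_in_set.
  pose Q k := [pred t | Z t & P t == (k \in A)].
  transitivity (\sum_(c in family Q) (\prod_k w (c k)) * F #|A|).
    apply: eq_big => [c|c /andP[_ /eqP<-] //]; apply/andP/familyP.
      move=> [/ffun_onP cZ /eqP cA] k.
      by rewrite inE -cA /successes inE eqxx andbT; exact: cZ.
    move=> cQ; split.
      by apply/ffun_onP => k; have /andP[] := cQ k.
    by apply/eqP/setP => k; rewrite inE; have /andP[_ /eqP] := cQ k.
  rewrite -mulr_suml -(bigA_distr_big_dep Q (fun=> w)); congr (_ * _).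
  apply: eq_bigr => k _; case: ifP => kA; rewrite -?w_failure /p.
    by apply: eq_bigl => t; rewrite /= kA eqb_id.
  by apply: eq_bigl => t; rewrite /= kA eqbF_neg.
rewrite (sum_card_set _ (fun n => p ^+ n * (1 - p) ^+ (#|I| - n) * F n)).
by apply: eq_bigr => i _; rewrite -!mulrA mulr_natl.
Qed.

Lemma sum_scaled_pair (R : pzSemiRingType) (I J : finType) (A : pred I)
    (u : I -> R) (F : I -> J -> R) :
  \sum_(i | A i) u i * \sum_j F i j = \sum_(x | A x.1) u x.1 * F x.1 x.2.
Proof.
under eq_bigr => i _ do rewrite mulr_sumr.
by rewrite pair_big /=; apply: eq_bigl => x; rewrite andbT.
Qed.

End IndependentTrials.

Section SubsetCounting.
Implicit Types (d s : nat).

Definition bit_support d (z : {ffun 'I_d -> bool}) : {set 'I_d} :=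
  [set i | z i]%SET.

Lemma bit_support_inj d : injective (@bit_support d).
Proof.
by move=> z w /setP zw; apply/ffunP => i; have := zw i; rewrite !inE.
Qed.

Lemma in_ZsetE d s (z : {ffun 'I_d -> bool}) :
  (z \in Zset d s) = (#|bit_support z| == s).
Proof. by rewrite inE -sum1dep_card [in RHS]big_mkcond. Qed.

Lemma card_Zset_sub d s (B : {set 'I_d}) :
  #|[set z in Zset d s | bit_support z \subset B]%SET| = 'C(#|B|, s).
Proof.
rewrite -cards_draws -(card_imset _ (@bit_support_inj d)).
apply: eq_card => A; rewrite inE; apply/imsetP/idP => [[z + ->]|].
  by rewrite inE in_ZsetE andbC.
have bit_supportK : bit_support [ffun i => i \in A] = A.
  by apply/setP => i; rewrite inE ffunE.
by exists [ffun i => i \in A]; rewrite // inE in_ZsetE bit_supportK andbC.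
Qed.

Lemma card_Zset d s : #|Zset d s| = 'C(d, s).
Proof.
rewrite -[d in RHS]card_ord -cardsT -card_Zset_sub.
by apply: eq_card => z; rewrite !inE finset.subsetT andbT.
Qed.

Lemma card_Zset_notin d s (j : 'I_d) :
  #|[set z in Zset d s | ~~ z j]%SET| = 'C(d.-1, s).
Proof.
rewrite -[d in RHS]card_ord -(cardsC1 j) -card_Zset_sub.
by apply: eq_card => z; rewrite !inE finset.subsetC finset.sub1set !inE.
Qed.

Lemma card_Zset_in d s (j : 'I_d) : (0 < s)%N ->
  #|[set z in Zset d s | z j]%SET| = 'C(d.-1, s.-1).
Proof.
move=> s0; have := card_bool_pred (mem (Zset d s)) (fun z => z j).
rewrite card_Zset card_Zset_notin.
case: d s j s0 => [|d] [|s] [] // k kd _; rewrite binS addnC => /eqP.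
by rewrite eqn_add2r => /eqP.
Qed.

Lemma card_Zset_in_ratio (F : numFieldType) d s (j : 'I_d) : (0 < s <= d)%N ->
  #|[set z in Zset d s | z j]%SET|%:R / #|Zset d s|%:R = s%:R / d%:R :> F.
Proof.
move=> /andP[s0 sd]; rewrite card_Zset_in // card_Zset.
have d0 : (0 < d)%N by apply: leq_trans s0 sd.
apply/eqP; rewrite eqr_div ?pnatr_eq0 -?lt0n ?bin_gt0 // -!natrM eqr_nat.
by case: s s0 {sd} => // s _; rewrite mulnC mul_bin_diag.
Qed.

End SubsetCounting.

Section Debiasing.
Variable F : fieldType.
Implicit Types d s P : F.

(* When a random [s]-subset contains [j] with probability [P] and the other
   coordinates are equally likely, [debias_shift] is their common probability,
   [(z - debias_shift) / debias_scale] is unbiased for [e_j], and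
   [subset_variance] is the sum of the variances of all the bits of [z]. *)
Definition debias_shift d s P : F := (s - P) / (d - 1).

Definition debias_scale d s P : F := P - debias_shift d s P.

Definition subset_variance d s P : F := s - P ^+ 2 - (s - P) ^+ 2 / (d - 1).

Definition debiased_mse d s P : F :=
  subset_variance d s P / debias_scale d s P ^+ 2.

Lemma debias_scaleE d s P : d != 0 -> d != 1 ->
  debias_scale d s P = d / (d - 1) * (P - s / d).
Proof.
move=> d0; rewrite -subr_eq0 => d1.
by rewrite /debias_scale /debias_shift; field; rewrite d0 d1.
Qed.

Lemma subset_varianceB d s P Q : d != 1 ->
  subset_variance d s P - subset_variance d s Q =
  (Q - P) * (debias_scale d s P + debias_scale d s Q).
Proof.
rewrite -subr_eq0 => d1.
by rewrite /subset_variance /debias_scale /debias_shift; field.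
Qed.

End Debiasing.

Section SquaredError.
Variable R : realType.
Implicit Types m b : R.

Lemma sqerrE (d s : nat) m b (j : 'I_d) z : m != 0 -> z \in Zset d s ->
  sqerr m b j z =
  (s%:R * (1 - 2 * b) + d%:R * b ^+ 2 + 2 * m * b + m ^+ 2) / m ^+ 2
  - 2 / m * (z j)%:R.
Proof.
move=> m0; rewrite inE => /eqP zs.
have termE i : (((z i)%:R - b) / m - (i == j)%:R) ^+ 2 =
    ((z i)%:R * (1 - 2 * b) + b ^+ 2) / m ^+ 2
    + (1 - 2 / m * ((z i)%:R - b)) *+ (i == j) :> R.
  by case: (z i); case: (i == j); rewrite /= ?mulr1n ?mulr0n; field.
rewrite /sqerr (eq_bigr _ (fun i _ => termE i)) big_split /= -mulr_suml.
under [X in _ + X = _]eq_bigr do rewrite mulrb.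
rewrite -big_mkcond big_pred1_eq big_split /= -mulr_suml -natr_sum zs.
by rewrite sumr_const card_ord -mulr_natl; field.
Qed.

Lemma mean_sqerr (d s : nat) (j : 'I_d) (I : finType) (A : pred I) (w : I -> R)
    (z : I -> {ffun 'I_d -> bool}) (P := \sum_(i | A i) w i * (z i j)%:R) :
    d%:R != 1 :> R -> (forall i, A i -> z i \in Zset d s) ->
    \sum_(i | A i) w i = 1 -> debias_scale d%:R s%:R P != 0 ->
  \sum_(i | A i) w i *
    sqerr (debias_scale d%:R s%:R P) (debias_shift d%:R s%:R P) j (z i) =
  debiased_mse d%:R s%:R P.
Proof.
rewrite -subr_eq0 => d1 zZ w1 m0; set m := debias_scale _ _ _ in m0 *.
set b := debias_shift _ _ _.
pose c := (s%:R * (1 - 2 * b) + d%:R * b ^+ 2 + 2 * m * b + m ^+ 2) / m ^+ 2.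
transitivity (\sum_(i | A i) (w i * c - w i * (z i j)%:R * (2 / m))).
  apply: eq_bigr => i Ai; rewrite (sqerrE _ _ m0 (zZ i Ai)) -/c.
  by field.
rewrite sumrB -!mulr_suml w1 mul1r -/P.
have bE : s%:R = P + (d%:R - 1) * b by rewrite /b /debias_shift; field.
have PE : P = m + b by rewrite /m /debias_scale subrK.
rewrite /debiased_mse /subset_variance -/m /c bE PE; field.
by rewrite m0 d1.
Qed.

End SquaredError.

Lemma expR_ge1 (R : realType) (x : R) : (1 <= expR x) = (0 <= x).
Proof. by rewrite -[leLHS]expR0 ler_expR. Qed.

Section TiltedBernoulli.
Variables (R : realType) (eps : R).
Implicit Types (p t a n : R).

(* The mass left after reweighting the successes of a Bernoulli([p]) trial by
   [expR eps]; [g_mrc eps p] is then the normalized probability of success. *)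
Definition tilt_mass p : R := expR eps * p + (1 - p).

Lemma g_mrcE p : g_mrc eps p = expR eps * p / tilt_mass p.
Proof. by []. Qed.

Lemma g_mrc_frac a n : n != 0 ->
  g_mrc eps (a / n) = expR eps * a / (expR eps * a + (n - a)).
Proof.
move=> n0; have massE : tilt_mass (a / n) = (expR eps * a + (n - a)) / n.
  by rewrite /tilt_mass; field.
by rewrite g_mrcE massE invf_div; move: (_ + (n - a))^-1 => mV; field.
Qed.

Hypothesis eps_ge0 : 0 <= eps.

Lemma tilt_mass_ge1 p : 0 <= p -> 1 <= tilt_mass p.
Proof.
move=> p0; have E1 : 1 <= expR eps by rewrite expR_ge1.
by rewrite /tilt_mass; nra.
Qed.

Lemma tilt_mass_neq0 p : 0 <= p -> tilt_mass p != 0.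
Proof. by move=> /tilt_mass_ge1 A1; rewrite gt_eqF // (lt_le_trans ltr01). Qed.

Lemma onem_g_mrc p : 0 <= p -> 1 - g_mrc eps p = (1 - p) / tilt_mass p.
Proof.
move=> /tilt_mass_neq0 A0; rewrite g_mrcE -[in LHS](divff A0) -mulrBl.
by rewrite /tilt_mass addrC addKr.
Qed.

Lemma g_mrc_subr p : 0 <= p ->
  g_mrc eps p - p = (expR eps - 1) * (p * (1 - p)) / tilt_mass p.
Proof.
move=> /tilt_mass_neq0 A0; rewrite g_mrcE -[X in _ - X](mulfK A0) -mulrBl.
by congr (_ / _); rewrite /tilt_mass; ring.
Qed.

Lemma g_mrc_excess_le p : 0 <= p <= 1 ->
  g_mrc eps p - p <= tilt_mass p * (1 - g_mrc eps p).
Proof.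
move=> /andP[p0 p1].
rewrite onem_g_mrc // mulrC divfK ?tilt_mass_neq0 // lerD2r.
rewrite -subr_ge0 onem_g_mrc //.
by rewrite divr_ge0 ?subr_ge0 // (le_trans _ (tilt_mass_ge1 p0)).
Qed.

Lemma g_mrc_taylor p t (A := tilt_mass p) : 0 <= p -> 0 <= t ->
  g_mrc eps t = g_mrc eps p + expR eps / A ^+ 2 * (t - p)
    - expR eps * (expR eps - 1) / A ^+ 2 * (t - p) ^+ 2 / tilt_mass t.
Proof.
move=> /tilt_mass_neq0 p0 /tilt_mass_neq0 t0.
move: p0 t0; rewrite !g_mrcE /A /tilt_mass => p0 t0; field.
by rewrite p0 t0.
Qed.

Lemma g_mrc_taylor_bounds p t (A := tilt_mass p) : 0 <= p -> 0 <= t ->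
  g_mrc eps p + expR eps / A ^+ 2 * (t - p)
    - expR eps * (expR eps - 1) / A ^+ 2 * (t - p) ^+ 2
  <= g_mrc eps t <= g_mrc eps p + expR eps / A ^+ 2 * (t - p).
Proof.
move=> p0 t0; rewrite (g_mrc_taylor p0 t0) -/A.
set r := _ * (t - p) ^+ 2; have B1 := tilt_mass_ge1 t0.
have r0 : 0 <= r.
  rewrite mulr_ge0 ?sqr_ge0 // divr_ge0 ?sqr_ge0 //.
  by rewrite mulr_ge0 ?expR_ge0 ?subr_ge0 ?expR_ge1.
rewrite lerB ?gerBl ?divr_ge0 ?(le_trans _ B1) //.
by rewrite ler_pdivrMr ?(lt_le_trans _ B1) // ler_peMr.
Qed.

Lemma Ebinom_g_mrc_gap (N : nat) p : (0 < N)%N -> 0 <= p <= 1 ->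
  0 <= g_mrc eps p - Ebinom N p (g_mrc eps)
    <= expR eps / N%:R / tilt_mass p * (g_mrc eps p - p).
Proof.
move=> N0 /[dup] p01 /andP[p0 p1]; set A := tilt_mass p.
apply/andP; split.
  rewrite subr_ge0 -[leRHS]addr0 -[X in _ + X](mul0r (p * (1 - p) / N%:R)).
  rewrite -(Ebinom_quadratic _ _ (expR eps / A ^+ 2)) //.
  apply: Ebinom_le => // t /andP[t0 _]; rewrite mul0r addr0.
  by have /andP[] := g_mrc_taylor_bounds p0 t0.
have gapE : expR eps / N%:R / A * (g_mrc eps p - p) =
    expR eps * (expR eps - 1) / A ^+ 2 * (p * (1 - p) / N%:R).
  by rewrite g_mrc_subr // -/A invfM; ring.
rewrite gapE lerBlDr addrC -lerBlDr -mulNr.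
rewrite -(Ebinom_quadratic _ _ (expR eps / A ^+ 2)) //.
apply: Ebinom_le => // t /andP[t0 _]; rewrite mulNr.
by have /andP[] := g_mrc_taylor_bounds p0 t0.
Qed.

End TiltedBernoulli.

Lemma g_mrc_gt (R : realType) (eps p : R) :
  0 < eps -> 0 < p < 1 -> p < g_mrc eps p.
Proof.
move=> eps0 /andP[p0 p1]; have [eps_ge0 p_ge0] := (ltW eps0, ltW p0).
rewrite -subr_gt0 g_mrc_subr // divr_gt0 //.
  by rewrite !mulr_gt0 ?subr_gt0 ?expR_gt1.
by rewrite (lt_le_trans _ (tilt_mass_ge1 eps_ge0 p_ge0)).
Qed.

Section Mechanisms.
Variables (R : realType) (d s : nat) (eps : R).
Hypotheses (s_gt0 : (0 < s)%N) (s_lt_d : (s < d)%N).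
Implicit Types (j : 'I_d).

Let d_gt0R : 0 < d%:R :> R.
Proof. by rewrite ltr0n (leq_ltn_trans _ s_lt_d). Qed.

Let d_gt1R : 1 < d%:R :> R.
Proof. by rewrite ltr1n (leq_ltn_trans s_gt0). Qed.

Let total : R := 'C(d.-1, s.-1)%:R * expR eps + 'C(d.-1, s)%:R.
Let weight (b : bool) : R := (if b then expR eps else 1) / total.

Let total_gt0 : 0 < total.
Proof.
rewrite /total ltr_wpDr // mulr_gt0 ?expR_gt0 // ltr0n bin_gt0.
by rewrite -ltnS !prednK // ltnW // (leq_ltn_trans _ s_lt_d).
Qed.

Lemma q_ss_gt0 j z : 0 < q_ss s eps j z.
Proof. by rewrite divr_gt0 //; case: (z j) => //; exact: expR_gt0. Qed.

Lemma mse_ss_ge0 j : 0 <= mse_ss s eps j.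
Proof.
apply: sumr_ge0 => z _; rewrite mulr_ge0 ?(ltW (q_ss_gt0 _ _)) //.
by apply: sumr_ge0 => i _; exact: sqr_ge0.
Qed.

Lemma sum_q_ss j : \sum_(z in Zset d s) q_ss s eps j z = 1.
Proof.
rewrite (sum_bool_pred _ (fun z : {ffun 'I_d -> bool} => z j) weight).
rewrite card_Zset_in // card_Zset_notin /weight !mulrA -mulrDl mulr1.
by rewrite mulfV ?lt0r_neq0.
Qed.

(* The normalization of [q_ss] cancels: on any finite family of candidates,
   importance sampling only sees the fraction of them that contain [j]. *)
Lemma q_ss_success_ratio j (I : finType) (A : pred I)
    (z : I -> {ffun 'I_d -> bool}) : (0 < #|A|)%N ->
  (\sum_(i | A i) q_ss s eps j (z i) * (z i j)%:R) /
  (\sum_(i | A i) q_ss s eps j (z i)) =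
  g_mrc eps (#|[set i | A i & z i j]%SET|%:R / #|A|%:R).
Proof.
move=> A0; rewrite g_mrc_frac ?pnatr_eq0 -?lt0n //.
rewrite (card_bool_pred A (fun i => z i j)) natrD [_ + _ - _]addrC addKr.
rewrite (sum_bool_pred A (fun i => z i j) weight).
rewrite (sum_bool_pred A (fun i => z i j) (fun b => weight b * b%:R)).
rewrite /weight /= mulr1 !mulr0 addr0 !mulrA -mulrDl invfM invrK mulr1.
by rewrite mulrACA mulVf ?lt0r_neq0 // mulr1 [_ * expR eps]mulrC.
Qed.

Lemma prob_ss j :
  \sum_(z in Zset d s) q_ss s eps j z * (z j)%:R = g_mrc eps (s%:R / d%:R).
Proof.
rewrite -(card_Zset_in_ratio R j) ?s_gt0 1?ltnW //.
rewrite -(@q_ss_success_ratio j _ (mem (Zset d s)) id) ?sum_q_ss ?divr1 //.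
by rewrite card_Zset bin_gt0 ltnW.
Qed.

Lemma mean_Cands_count N j (F : nat -> R) :
  \sum_(c in Cands N d s) (#|Zset d s|%:R ^+ N)^-1 * F #|[set k | c k j]%SET| =
  binom_mean N (s%:R / d%:R) F.
Proof.
have Z0 : #|Zset d s|%:R != 0 :> R.
  by rewrite pnatr_eq0 -lt0n card_Zset bin_gt0 ltnW.
have unif_sum1 : \sum_(z in Zset d s) #|Zset d s|%:R^-1 = 1 :> R.
  by rewrite sumr_const -[LHS]mulr_natl mulfV.
have unif_in : \sum_(z in Zset d s | z j) #|Zset d s|%:R^-1 = s%:R / d%:R :> R.
  rewrite sumr_const -[LHS]mulr_natl -(card_Zset_in_ratio R j) ?s_gt0 1?ltnW //.
  by congr (_%:R / _); rewrite cardsE.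
rewrite -unif_in -[N in RHS]card_ord.
pose has_j (z : {ffun 'I_d -> bool}) := z j.
rewrite -(mean_success_count 'I_N has_j F unif_sum1).
apply: eq_big => [c|c _]; last by rewrite prodr_const card_ord exprVn.
by rewrite inE; apply/forallP/ffun_onP.
Qed.

Section ImportanceSampling.
Variables (N : nat) (j : 'I_d).
Hypothesis N_gt0 : (0 < N)%N.

Lemma sum_pi_mrc c : \sum_(k < N) pi_mrc s eps j c k = 1.
Proof.
rewrite -mulr_suml mulfV // psumr_neq0 => [|k _]; last exact/ltW/q_ss_gt0.
by apply/hasP; exists (Ordinal N_gt0); rewrite ?mem_index_enum ?q_ss_gt0.
Qed.

Lemma prob_pi_mrc (c : {ffun 'I_N -> {ffun 'I_d -> bool}}) :
  \sum_(k < N) pi_mrc s eps j c k * (c k j)%:R =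
  g_mrc eps (#|[set k | c k j]%SET|%:R / N%:R).
Proof.
have := @q_ss_success_ratio j _ predT c; rewrite card_ord => <- //.
by rewrite mulr_suml; apply: eq_bigr => k _; rewrite mulrAC.
Qed.

Lemma mse_mrcE (P := Ebinom N (s%:R / d%:R) (g_mrc eps)) :
  debias_scale d%:R s%:R P != 0 ->
  mse_mrc N s eps j = debiased_mse d%:R s%:R P.
Proof.
have b_mrcE : b_mrc N d s eps = debias_shift d%:R s%:R P.
  by rewrite /b_mrc EbinomBl mulrC.
have m_mrcE : m_mrc N d s eps = debias_scale d%:R s%:R P.
  by rewrite /m_mrc EbinomBl [_^-1 * _]mulrC.
pose u : R := (#|Zset d s|%:R ^+ N)^-1; pose C := mem (Cands N d s).
have weights_sum1 : \sum_(x | C x.1) u * pi_mrc s eps j x.1 x.2 = 1.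
  rewrite -(sum_scaled_pair C (fun=> u) (pi_mrc s eps j)).
  under eq_bigr => c _ do rewrite sum_pi_mrc.
  by rewrite (mean_Cands_count N j (fun=> 1)) binom_mean_cst.
have prob_mrc :
    \sum_(x | C x.1) u * pi_mrc s eps j x.1 x.2 * (x.1 x.2 j)%:R = P.
  under eq_bigr => x _ do rewrite -mulrA.
  rewrite -(sum_scaled_pair C (fun=> u)
    (fun c k => pi_mrc s eps j c k * (c k j)%:R)).
  under eq_bigr => c _ do rewrite prob_pi_mrc.
  exact: (mean_Cands_count N j (fun n => g_mrc eps (n%:R / N%:R))).
rewrite /mse_mrc b_mrcE m_mrcE sum_scaled_pair -prob_mrc => m0.
under eq_bigr => x _ do rewrite mulrA.
apply: mean_sqerr m0 => // [|x]; first by rewrite gt_eqF.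
by rewrite /C /= inE => /forallP/(_ x.2).
Qed.

End ImportanceSampling.

Lemma mse_ssE j (P := g_mrc eps (s%:R / d%:R)) :
  debias_scale d%:R s%:R P != 0 ->
  mse_ss s eps j = debiased_mse d%:R s%:R P.
Proof.
set sR : R := s%:R in P *; set dR : R := d%:R in P *; move=> m0.
have mass_gt0 : 0 < sR * (expR eps - 1) + dR.
  have -> : sR * (expR eps - 1) + dR = expR eps * sR + (dR - sR) by ring.
  by rewrite ltr_wpDr ?mulr_gt0 ?expR_gt0 ?ltr0n // subr_ge0 ler_nat ltnW.
have PE : P = expR eps * sR / (sR * (expR eps - 1) + dR).
  rewrite /P g_mrc_frac ?lt0r_neq0 //; congr (_ / _); ring.
have denoms_neq0 : (dR - 1 != 0) && (sR * (expR eps - 1) + dR != 0).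
  by rewrite subr_eq0 gt_eqF // lt0r_neq0.
have b_ssE : b_ss d s eps = debias_shift dR sR P.
  by rewrite /b_ss /debias_shift PE; field.
have m_ssE : m_ss d s eps = debias_scale dR sR P.
  by rewrite /m_ss /debias_scale /debias_shift PE; field.
rewrite /mse_ss b_ssE m_ssE; move: m0; rewrite /P -(prob_ss j) => m0.
by apply: mean_sqerr m0; rewrite ?gt_eqF ?sum_q_ss.
Qed.

End Mechanisms.

Section DebiasedComparison.
Variables (R : realFieldType) (d s : R).
Hypotheses (s_ge1 : 1 <= s) (s_le : s + 1 <= d).
Implicit Types P Q : R.

Lemma debias_scale_gt0 P : s / d < P -> 0 < debias_scale d s P.
Proof.
move=> sdP; have [s1 sd] := (s_ge1, s_le).
rewrite debias_scaleE; [|by rewrite gt_eqF //; lra..].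
by rewrite mulr_gt0 ?subr_gt0 // divr_gt0; lra.
Qed.

Lemma bit_variance_le Q : 0 <= Q <= 1 -> Q * (1 - Q) <= subset_variance d s Q.
Proof.
move=> /andP[Q0 Q1]; have [s1 sd] := (s_ge1, s_le).
have d1 : d - 1 != 0 by rewrite gt_eqF //; lra.
have -> : subset_variance d s Q =
    Q * (1 - Q) + (s - Q) * (d - 1 - (s - Q)) / (d - 1).
  by rewrite /subset_variance; field.
by rewrite lerDl divr_ge0 ?mulr_ge0; lra.
Qed.

Section Perturbation.
Variables (P Q A delta : R).
Hypotheses (sd_lt_Q : s / d < Q) (A_ge1 : 1 <= A).
Hypothesis excess_le : Q - s / d <= A * (1 - Q).
Hypotheses (delta_ge0 : 0 <= delta) (delta_lt1 : delta < 1).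
Hypothesis gap : 0 <= Q - P <= delta / A * (Q - s / d).

Let A_gt0 : 0 < A. Proof. exact: lt_le_trans A_ge1. Qed.

Let Q_in01 : 0 < Q < 1.
Proof.
have [s1 sd] := (s_ge1, s_le).
have sd0 : 0 < s / d by rewrite divr_gt0; lra.
rewrite (lt_trans sd0) //= -subr_gt0 -(pmulr_rgt0 _ A_gt0).
by rewrite (lt_le_trans _ excess_le) // subr_gt0.
Qed.

Lemma debias_scale_perturb :
  0 < (1 - delta) * debias_scale d s Q <= debias_scale d s P.
Proof.
have [s1 sd] := (s_ge1, s_le); rewrite mulr_gt0 ?debias_scale_gt0 ?subr_gt0 //=.
have gap_delta : Q - P <= delta * (Q - s / d).
  have /andP[_ /le_trans] := gap; apply.
  rewrite ler_wpM2r ?subr_ge0 ?(ltW sd_lt_Q) //.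
  by rewrite ler_pdivrMr // ler_peMr.
rewrite !debias_scaleE; [|by rewrite gt_eqF //; lra..].
by rewrite mulrCA ler_pM2l; [lra|rewrite divr_gt0; lra].
Qed.

Lemma subset_variance_perturb :
  subset_variance d s P <= (1 + 2 * delta) * subset_variance d s Q.
Proof.
have [s1 sd] := (s_ge1, s_le); have /andP[Q0 Q1] := Q_in01.
have /andP[QP0 QP] := gap; have /andP[scale_gt0 scaleP] := debias_scale_perturb.
have scale_leQ : debias_scale d s Q <= Q.
  by rewrite /debias_scale /debias_shift gerBl divr_ge0; lra.
have scale_le : debias_scale d s P <= debias_scale d s Q.
  by rewrite /debias_scale /debias_shift lerB ?ler_wpM2r ?invr_ge0; lra.
have increment : (Q - P) * (debias_scale d s P + debias_scale d s Q) <=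
    delta * (1 - Q) * (2 * Q).
  have gap_onem : Q - P <= delta * (1 - Q).
    apply: (le_trans QP); rewrite -mulrA ler_wpM2l // mulrC ler_pdivrMr //.
    by rewrite [leRHS]mulrC.
  by apply: ler_pM; lra.
have bitQ : delta * (Q * (1 - Q)) <= delta * subset_variance d s Q.
  by rewrite ler_wpM2l // bit_variance_le // !ltW.
have := subset_varianceB s P Q (_ : d != 1); rewrite gt_eqF //; last by lra.
by move=> /(_ isT); lra.
Qed.

Lemma debiased_mse_perturb :
  debiased_mse d s P <= (1 + 2 * delta) / (1 - delta) ^+ 2 * debiased_mse d s Q.
Proof.
have [delta0 /andP[scaleQ0 scale_le]] := (delta_ge0, debias_scale_perturb).
have varQ0 : 0 <= subset_variance d s Q.
  have /andP[Q0 Q1] := Q_in01; apply: le_trans (bit_variance_le _).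
    by rewrite mulr_ge0; lra.
  by rewrite !ltW.
have -> : (1 + 2 * delta) / (1 - delta) ^+ 2 * debiased_mse d s Q =
    (1 + 2 * delta) * subset_variance d s Q /
    ((1 - delta) * debias_scale d s Q) ^+ 2.
  by rewrite /debiased_mse mulrACA -invfM -exprMn.
apply: (le_trans (ler_wpM2r _ subset_variance_perturb)).
  by rewrite invr_ge0 sqr_ge0.
have scaleP0 := lt_le_trans scaleQ0 scale_le.
rewrite ler_wpM2l ?mulr_ge0 //; first by lra.
by rewrite lef_pV2 ?posrE ?exprn_gt0 // lerXn2r ?nnegrE // ltW.
Qed.

End Perturbation.
End DebiasedComparison.

Lemma mse_mrc_le (R : realType) (eps : R) (N d s : nat) (j : 'I_d)
    (delta := expR eps / N%:R) :
    0 < eps -> (0 < N)%N -> (0 < s < d)%N -> delta < 1 ->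
  mse_mrc N s eps j <= (1 + 2 * delta) / (1 - delta) ^+ 2 * mse_ss s eps j.
Proof.
move=> eps0 N0 /andP[s0 sd] delta1; pose p : R := s%:R / d%:R.
have [s1R sdR] : 1 <= s%:R :> R /\ s%:R + 1 <= d%:R :> R.
  by rewrite ler1n natr1 ler_nat.
have p_in01 : 0 < p < 1 by rewrite divr_gt0 ?ltr_pdivrMr; lra.
have [p0 p_le1] : 0 <= p /\ p <= 1 by case/andP: p_in01 => /ltW p0 /ltW.
have p01 : 0 <= p <= 1 by rewrite p0.
have mass1 := tilt_mass_ge1 (ltW eps0) p0.
have excess := g_mrc_excess_le (ltW eps0) p01.
have p_lt_g := g_mrc_gt eps0 p_in01.
have delta0 : 0 <= delta by rewrite divr_ge0 ?expR_ge0.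
have gap := Ebinom_g_mrc_gap (ltW eps0) N0 p01.
have /andP[scale0 scale_le] :=
  debias_scale_perturb s1R sdR p_lt_g mass1 delta0 delta1 gap.
rewrite mse_mrcE ?mse_ssE //; first exact: debiased_mse_perturb excess _ _ gap.
  by rewrite lt0r_neq0 // debias_scale_gt0.
by rewrite lt0r_neq0 // (lt_le_trans scale0).
Qed.

Lemma ln_ge1BV (R : realType) (x : R) : 0 < x -> 1 - x^-1 <= ln x.
Proof.
move=> x0; rewrite -lerN2 opprB -lnV // -[in leLHS](subrKC 1 x^-1).
by apply: le_ln1Dx; rewrite ltrBrDl subrr invr_gt0.
Qed.

Lemma sample_size_bound (R : realType) (E lambda n : R) :
  1 <= E -> 0 < lambda ->
  (2 * (E + 3) ^+ 2 * (1 + lambda) ^+ 2) / ((24 / 100) ^+ 2 * lambda ^+ 2)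
    * ln ((8 * (1 + lambda)) / ((24 / 100) * lambda)) <= n ->
  E * (1 + lambda) <= lambda * n.
Proof.
move=> E1 lambda0; set r := (1 + lambda) / lambda.
have r1 : 1 <= r by rewrite ler_pdivlMr // mul1r lerDr.
have -> : (2 * (E + 3) ^+ 2 * (1 + lambda) ^+ 2) /
    ((24 / 100) ^+ 2 * lambda ^+ 2) = 2 / (24 / 100) ^+ 2 * ((E + 3) * r) ^+ 2.
  by rewrite /r; field; rewrite lt0r_neq0.
have -> : (8 * (1 + lambda)) / ((24 / 100) * lambda) = 8 / (24 / 100) * r.
  by rewrite /r; field; rewrite lt0r_neq0.
set x := 8 / _ * r => nE.
have ln_ge : 1 / 2 <= ln x.
  have x2 : 2 <= x by rewrite /x; lra.
  apply: le_trans (ln_ge1BV _); last by lra.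
  have : x^-1 <= 1 / 2 by rewrite -div1r ler_pdivrMr; lra.
  by lra.
set y := (E + 3) * r in nE.
have Er_ge1 : 1 <= E * r by rewrite mulr_ege1.
have Er_le : E * r <= y by rewrite ler_wpM2r; lra.
have y_le_sqr : y <= y ^+ 2 by rewrite ler_eXnr //; lra.
have ln_sqr : y ^+ 2 * (1 / 2) <= y ^+ 2 * ln x by rewrite ler_wpM2l ?sqr_ge0.
have : E * r <= n by lra.
by rewrite mulrA ler_pdivrMr // [n * _]mulrC.
Qed.

Lemma mse_factor_le (R : realFieldType) (delta lambda : R) :
  0 <= delta -> 0 <= lambda -> delta * (1 + lambda) <= lambda ->
  (1 + 2 * delta) / (1 - delta) ^+ 2 <= (1 + lambda) ^+ 2 * (1 + 2 * lambda).
Proof.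
move=> delta0 lambda0 small.
have delta_le : delta <= lambda.
  by rewrite (le_trans _ small) // ler_peMr // lerDl.
have prod_ge1 : 1 <= (1 + lambda) * (1 - delta) by lra.
have delta1 : 0 < 1 - delta.
  by rewrite -(@pmulr_rgt0 _ (1 + lambda)); lra.
rewrite ler_pdivrMr ?exprn_gt0 // mulrAC -exprMn.
apply: (@le_trans _ _ (1 + 2 * lambda)); first by lra.
by rewrite ler_peMl ?exprn_ege1 //; lra.
Qed.

Lemma ss_s_bounds (R : realType) (d : nat) (eps : R) :
  (1 < d)%N -> 0 <= eps -> (0 < ss_s d eps < d)%N.
Proof.
move=> d1 eps0; have E1 : 1 <= expR eps by rewrite expR_ge1.
set x := d%:R / (1 + expR eps).
have d2 : 2 <= d%:R :> R by rewrite ler_nat.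
have x0 : 0 < x by rewrite divr_gt0; lra.
have x_le : x <= d%:R / 2 by rewrite ler_wpM2l ?lef_pV2 ?posrE //; lra.
have sE : (ss_s d eps)%:Z = Num.ceil x.
  by rewrite /ss_s gez0_abs // ltW // ceil_gt0.
rewrite -!ltz_nat sE ceil_gt0 x0 -(ltr_int R) /=.
by have := ceilB1_lt x; rewrite intrB /=; lra.
Qed.

Theorem theorem11 (R : realType) (d : nat) (eps lambda : R) (N : nat) :
  (2 <= d)%N -> 1 <= eps -> 0 < lambda ->
  (2 * (expR eps + 3) ^+ 2 * (1 + lambda) ^+ 2) / ((24 / 100) ^+ 2 * lambda ^+ 2)
    * ln ((8 * (1 + lambda)) / ((24 / 100) * lambda)) <= N%:R ->
  forall j : 'I_d,
    mse_mrc N (ss_s d eps) eps j <=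
    (1 + 4 * lambda + 5 * lambda ^+ 2 + 2 * lambda ^+ 3) * mse_ss (ss_s d eps) eps j.
Proof.
move=> d2 eps1 lambda0 N_large j.
have eps0 : 0 < eps by lra.
have N_ge : expR eps * (1 + lambda) <= lambda * N%:R.
  by apply: sample_size_bound N_large; rewrite ?expR_ge1 ?(ltW eps0).
have N0 : (0 < N)%N.
  rewrite -(ltr0n R) -(pmulr_rgt0 _ lambda0) (lt_le_trans _ N_ge) //.
  by rewrite mulr_gt0 ?expR_gt0 // addr_gt0.
have delta_small : expR eps / N%:R * (1 + lambda) <= lambda.
  by rewrite mulrAC ler_pdivrMr ?ltr0n.
have delta_lt1 : expR eps / N%:R < 1.
  by rewrite -(ltr_pM2r (_ : 0 < 1 + lambda)); lra.
have s_bounds := ss_s_bounds d2 (ltW eps0).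
apply: (le_trans (mse_mrc_le j eps0 N0 s_bounds delta_lt1)).
have -> : 1 + 4 * lambda + 5 * lambda ^+ 2 + 2 * lambda ^+ 3 =
    (1 + lambda) ^+ 2 * (1 + 2 * lambda) by ring.
have /andP[s0 sd] := s_bounds; rewrite ler_wpM2r ?mse_ss_ge0 //.
by rewrite mse_factor_le ?divr_ge0 ?expR_ge0 ?(ltW lambda0).
Qed.
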